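(* Let $a,b\in\mathbb Z$ and let $m$ be a positive integer. Define $w_0=a$, $w_1=b$, $w_n=w_{n-1}+w_{n-2}$ for $n\ge 2$. Then the sequence $(w_n)$ reduced modulo $m$ is residue complete (i.e. for every $x\in\mathbb Z_m$ there is $n\ge 0$ with $w_n\equiv x \pmod m$) if and only if $$m\in\mathcal F=\{5^k,\ 2\cdot 5^k,\ 4\cdot 5^k,\ 3^j5^k,\ 6\cdot 5^k,\ 7\cdot 5^k,\ 14\cdot 5^k \,:\, k\ge 0,\ j\ge 1\}$$ and $\gcd(m,\, b^2-ab-a^2)=1$.
   Context: For fixed integers $a,b$, the sequence $w_n=w_n(a,b)$ is defined by $w_0=a$, $w_1=b$, $w_n=w_{n-1}+w_{n-2}$. Modulo $m$ this sequence is periodic; a period of it modulo $m$ is called a Fibonacci cycle modulo $m$ and denoted $w(a,b,m)$. The cycle $w(a,b,m)$ is called residue complete if every residue class $x\in\mathbb Z_m$ occurs among its terms (equivalently, among the $w_n \bmod m$). *)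

(* Defs.v *)
From mathcomp Require Import all_boot all_order all_algebra.
Set Implicit Arguments.
Unset Strict Implicit.
Unset Printing Implicit Defensive.
Import Order.TTheory GRing.Theory Num.Theory.
Local Open Scope ring_scope.

Fixpoint wseq (a b : int) (n : nat) {struct n} : int :=
  match n with
  | 0%N => a
  | 1%N => b
  | (k.+1 as k').+1 => wseq a b k' + wseq a b k
  end.

(* Residue classes modulo m are given by integer representatives x. This avoids
   'Z_m, which is Z/2 rather than the trivial ring when m = 1. *)
Definition residue_complete (a b : int) (m : nat) : Prop :=
  forall x : int, exists n : nat, (wseq a b n = x %[mod m%:Z])%Z.

Definition famF (m : nat) : Prop :=
  exists k : nat,
       m = (5 ^ k)%N
    \/ m = (2 * 5 ^ k)%N
    \/ m = (4 * 5 ^ k)%N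
    \/ (exists j : nat, (1 <= j)%N /\ m = (3 ^ j * 5 ^ k)%N)
    \/ m = (6 * 5 ^ k)%N
    \/ m = (7 * 5 ^ k)%N
    \/ m = (14 * 5 ^ k)%N.

(* Main.v *)
(* If w is complete modulo m then, up to a shift, w_0 = 0 modulo m, so that
   w_n = u F_n for the Fibonacci sequence F and u = w_1. As 1 is a value, u is a
   unit; hence F is complete modulo m and the norm b ^ 2 - a b - a ^ 2, which is
   u ^ 2 up to sign, is prime to m.
   Divisors of m inherit completeness, and the moduli 8, 12, 18, 21, 28, 49 and
   the primes p > 7 are impossible for F:
   - if 5 is a square mod p, F has period p - 1 and F_1 = F_2;
   - if 5 is not a square and p = 1 mod 4, put h = (p + 1) / 2: then F_h = 0,
     so F_(n+h) = g F_n with g ^ 2 = -1, and F_(h-n) = g F_n up to sign; thus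
     F_n ^ 4 takes at most (p - 1) / 4 values, too few for the p classes;
   - if 5 is not a square and p = 3 mod 4, let v - 1, v, v + 1 be non-residues.
     Then 4 v / 5 is a square, so it is F_n ^ 2 for some n, and
     5 F_n ^ 2 + 4 (-1) ^ n = 4 (v +- 1) is a square, a contradiction.
   Conversely, w is proportional to F modulo m as soon as it has a zero, which
   settles small moduli by computation. Completeness then lifts from m to r m
   when r divides m: if A ^ T = 1 + m B for the companion matrix A, the terms
   w_(n + iT), i < r, are congruent to w_n modulo m and run through its r lifts
   modulo r m, provided that B_00 and w_(n+1) + w_(n-1) are prime to r. *)
Require Import Defs.
From mathcomp Require Import all_boot all_order all_algebra finfield.
From mathcomp Require Import zify ring.
Set Implicit Arguments.
Unset Strict Implicit.
Unset Printing Implicit Defensive.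
Import GRing.Theory.
Local Open Scope ring_scope.

Lemma dvdz_congr (d x y : int) : (d %| x - y)%Z -> (d %| x)%Z = (d %| y)%Z.
Proof. by move=> dxy; rewrite -(subrK y x) rpredDl. Qed.

Lemma gcdz_congr (d x y : int) : (d %| x - y)%Z -> gcdz d x = gcdz d y.
Proof. by case/dvdzP=> z /eqP; rewrite subr_eq => /eqP ->; rewrite gcdzMDl. Qed.

Lemma coprimez_congr (d x y : int) :
  (d %| x - y)%Z -> coprimez d x = coprimez d y.
Proof. by rewrite /coprimez => /gcdz_congr ->. Qed.

Lemma coprimez_linear_solvable (d : nat) (x u : int) :
  (0 < d)%N -> coprimez d u ->
  exists i : nat, (d %| x + i%:Z * u)%Z.
Proof.
move=> d_gt0 /coprimezP [[c v] /= cv].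
exists `|((- x * v) %% d)%Z|%N; rewrite gez0_abs ?modz_ge0 -?lt0n //.
apply/dvdzP; exists (x * c - (- x * v %/ d)%Z * u).
rewrite /modz -[X in X + _](mulr1 x) -cv; ring.
Qed.

Lemma expr1D_scale (A : algType int) (m d : int) (x : A) n :
  (forall i, (1 < i <= n)%N -> (d %| m ^+ i *+ 'C(n, i))%Z) ->
  exists y, (1 + m *: x) ^+ n = 1 + (m *+ n) *: x + d *: y.
Proof.
case: n => [|n] d_dvd.
  by exists 0; rewrite expr0 mulr0n scale0r scaler0 !addr0.
exists (\sum_(i < n) ((m ^+ i.+2 *+ 'C(n.+1, i.+2)) %/ d)%Z *: x ^+ i.+2).
rewrite addrC exprD1n 2!big_ord_recl bin0 expr0 bin1 expr1 scalerMnl addrA.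
congr (_ + _); rewrite scaler_sumr; apply: eq_bigr => i _.
by rewrite exprZn scalerMnl scalerA mulrC divzK // d_dvd //= ltnS.
Qed.

Lemma prod_pfactor (s : seq nat) (m : nat) :
  (0 < m)%N -> uniq s -> {subset primes m <= s} ->
  m = (\prod_(p <- s) p ^ logn p m)%N.
Proof.
move=> m_gt0 s_uniq sub_s; rewrite {1}(prod_prime_decomp m_gt0) prime_decompE.
rewrite big_map [RHS](bigID [in primes m]) /=.
rewrite [X in (_ * X)%N]big1 => [|p]; last first.
  by rewrite -logn_gt0 -eqn0Ngt => /eqP ->.
rewrite muln1 -[RHS]big_filter; apply: perm_big; apply: uniq_perm.
- exact: primes_uniq.
- exact: filter_uniq.
by move=> p; rewrite mem_filter; case: (boolP (p \in primes m)) => // /sub_s ->.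
Qed.

Lemma dvdz_Zp (m : nat) (x : int) :
  (1 < m)%N -> (m%:Z %| x)%Z = (x%:~R == 0 :> 'Z_m).
Proof.
move=> m_gt1; suff dvdn_Zp k : (m %| k)%N = (k%:R == 0 :> 'Z_m).
  by case: x => k; rewrite dvdzE dvdn_Zp ?NegzE ?rmorphN ?oppr_eq0.
by rewrite -val_eqE /= val_Zp_nat.
Qed.

Lemma periodic_modn (T : Type) (v : nat -> T) N :
  (forall n, v (n + N)%N = v n) -> forall n, v (n %% N)%N = v n.
Proof.
move=> period n; rewrite {2}(divn_eq n N) addnC; elim: (n %/ N)%N => [|i IHi].
  by rewrite addn0.
by rewrite mulSn addnCA addnC period.
Qed.

Lemma card_leq_exp_image (F : finFieldType) d (s : seq F) :
  (0 < d)%N -> (forall x : F, x ^+ d \in s) -> (#|F| <= d * size s)%N.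
Proof.
move=> d_gt0 im_s; pose q := \prod_(c <- s) ('X^d - c%:P).
have q_monic : q \is monic by apply: monic_prod => c _; apply: monicXnsubC.
have q_size : size q = (d * size s).+1.
  rewrite size_prod_seq => [|c _]; last exact/monic_neq0/monicXnsubC.
  under eq_bigr do rewrite size_XnsubC //.
  by rewrite big_const_seq count_predT iter_addn addn0 mulSn -addnS addKn.
rewrite -ltnS -q_size cardE; apply: max_poly_roots (enum_uniq _).
  exact: monic_neq0.
apply/allP => x _; rewrite /root horner_prod prodf_seq_eq0.
by apply/hasP; exists (x ^+ d) => //=; rewrite !hornerE subrr.
Qed.

Lemma natr_Fp_neq0 (p n : nat) :
  prime p -> (0 < n < p)%N -> n%:R != 0 :> 'F_p.
Proof.
move=> p_prime /andP [n_gt0 n_lt].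
by rewrite -(dvdn_pcharf (pchar_Fp p_prime)) gtnNdvd.
Qed.

(** * The quadratic character of a finite field *)

Section QuadraticCharacter.
Variable F : finFieldType.
Hypothesis odd_F : odd #|F|.

(* Euler's criterion; #|F|./2 = (#|F| - 1) / 2 since #|F| is odd. *)
Definition quad_char (x : F) : F := x ^+ #|F|./2.
Local Notation chi := quad_char.

Lemma quad_charM x y : chi (x * y) = chi x * chi y.
Proof. exact: exprMn. Qed.

Lemma quad_charV x : chi x^-1 = (chi x)^-1.
Proof. exact: exprVn. Qed.

Lemma quad_char1 : chi 1 = 1.
Proof. exact: expr1n. Qed.

Lemma quad_char_sqr x : x != 0 -> chi (x ^+ 2) = 1.
Proof.
move=> x_neq0; apply: (mulfI x_neq0); rewrite /chi -exprM mul2n -exprS mulr1.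
by rewrite -[RHS]expf_card -[in RHS](odd_double_half #|F|) odd_F.
Qed.

Lemma quad_char4 : 2 != 0 :> F -> chi 4 = 1.
Proof. by rewrite (_ : 4 = 2 ^+ 2); [exact: quad_char_sqr | ring]. Qed.

Lemma quad_char_sign x : x != 0 -> chi x = 1 \/ chi x = -1.
Proof.
move/quad_char_sqr => /eqP; rewrite expr2 quad_charM -expr2 sqrf_eq1.
by case/orP=> /eqP; [left | right].
Qed.

Lemma quad_char_eqN1_neq0 x : chi x = -1 -> x != 0.
Proof.
apply: contra_eq_neq => ->; rewrite /chi expr0n; have := finNzRing_gt1 F.
rewrite -[#|F|]odd_double_half odd_F; case: _./2 => //= k _.
by rewrite eq_sym oppr_eq0 oner_eq0.
Qed.

Lemma sqr_quad_char1 x :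
  odd #|F|./2 -> chi x = 1 -> (x ^+ uphalf #|F|./2) ^+ 2 = x.
Proof.
move=> odd_k chi1; rewrite -exprM muln2 uphalfE -[in RHS](mulr1 x) -chi1 -exprS.
by rewrite -[in RHS](odd_double_half #|F|./2) odd_k; congr (_ ^+ _); lia.
Qed.

Hypotheses (two_neq0 : 2 != 0 :> F) (three_neq0 : 3 != 0 :> F).
Hypotheses (seven_neq0 : 7 != 0 :> F) (odd_k : odd #|F|./2).

Lemma quad_charN x : chi (- x) = - chi x.
Proof. by rewrite -mulN1r quad_charM /chi -signr_odd odd_k mulN1r. Qed.

(* Up to sign v is 2, 1/3 or 1/7, according to the characters of 2 and 3. *)
Lemma consecutive_quad_char_eqN1 :
  exists v, [/\ chi (v - 1) = -1, chi v = -1 & chi (v + 1) = -1].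
Proof.
have chi4 := quad_char4 two_neq0.
suff [r [r_neq0 chiB chiD]] :
    exists r, [/\ r != 0, chi (r - 1) = chi r & chi (r + 1) = chi r].
  have [chi_r|chi_r] := quad_char_sign r_neq0; last first.
    by exists r; rewrite chiB chiD.
  exists (- r); rewrite -opprD (_ : - r + 1 = - (r - 1)); last by ring.
  by rewrite !quad_charN chiB chiD chi_r.
have [chi2|chi2] := quad_char_sign two_neq0; last first.
  exists 3^-1; split; first by rewrite invr_eq0.
    rewrite (_ : 3^-1 - 1 = - (2 * 3^-1)); last by field.
    by rewrite quad_charN quad_charM chi2 mulN1r opprK.
  rewrite (_ : 3^-1 + 1 = 4 * 3^-1); last by field.
  by rewrite quad_charM chi4 mul1r.
have [chi3|chi3] := quad_char_sign three_neq0.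
  exists 2; split=> //; rewrite chi2.
    by rewrite (_ : 2 - 1 = 1) ?quad_char1 //; ring.
  by rewrite (_ : 2 + 1 = 3) //; ring.
exists 7^-1; split; first by rewrite invr_eq0.
  rewrite (_ : 7^-1 - 1 = - (2 * (3 * 7^-1))); last by field.
  by rewrite quad_charN !quad_charM chi2 chi3 mul1r mulN1r opprK.
rewrite (_ : 7^-1 + 1 = 4 * (2 * 7^-1)); last by field.
by rewrite !quad_charM chi4 chi2 !mul1r.
Qed.
End QuadraticCharacter.

(** * The recurrence and its companion matrix *)

Local Notation fib := (wseq 0 1).
Local Notation wnorm a b := (b ^+ 2 - a * b - a ^+ 2).

Lemma wseqSS (a b : int) n : wseq a b n.+2 = wseq a b n.+1 + wseq a b n.
Proof. by []. Qed.

Lemma wseqD (a b : int) n k :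
  wseq a b (n + k) = fib k * wseq a b n.+1 + (fib k.+1 - fib k) * wseq a b n.
Proof.
suff [] : wseq a b (n + k) = fib k * wseq a b n.+1 +
             (fib k.+1 - fib k) * wseq a b n /\
          wseq a b (n + k.+1) = fib k.+1 * wseq a b n.+1 +
             fib k * wseq a b n by [].
elim: k => [|k [IHk IHk1]]; first by rewrite addn0 addn1 /=; split; ring.
split; first by rewrite IHk1 wseqSS; ring.
by rewrite !addnS wseqSS -addnS IHk IHk1 wseqSS; ring.
Qed.

Lemma wseq_shift (a b : int) n k :
  wseq (wseq a b n) (wseq a b n.+1) k = wseq a b (n + k).
Proof. by rewrite -[in LHS](add0n k) !wseqD. Qed.

Lemma wseq_norm (a b : int) n :
  wnorm (wseq a b n) (wseq a b n.+1) = (-1) ^+ n * wnorm a b.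
Proof.
elim: n => [|n IHn]; first by rewrite /= mul1r.
by rewrite [(-1) ^+ _]exprS -mulrA -IHn wseqSS; ring.
Qed.

Lemma fib_norm n : wnorm (fib n) (fib n.+1) = (-1) ^+ n.
Proof. by rewrite wseq_norm expr1n mul0r expr0n !subr0 mulr1. Qed.

Arguments wseq : simpl never.

(* w_(n+1) + w_(n-1): the Lucas numbers when w = fib. *)
Definition wlucas (a b : int) n := 2 * wseq a b n.+1 - wseq a b n.

Lemma wlucas_sqr (a b : int) n :
  wlucas a b n ^+ 2 = 5 * wseq a b n ^+ 2 + 4 * ((-1) ^+ n * wnorm a b).
Proof. by rewrite -wseq_norm /wlucas; ring. Qed.

Definition fibmx (R : comNzRingType) : 'M[R]_2 :=
  \matrix_(i, j) (0 < i + j)%N%:R.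

Lemma fibmx_sqr (R : comNzRingType) : fibmx R ^+ 2 = fibmx R + 1.
Proof.
apply/matrixP=> i j; rewrite expr2 -mulmxE !mxE !big_ord_recl big_ord0 !mxE.
by case: i j => [[|[|//]] ?] [[|[|//]] ?] /=; ring.
Qed.

Lemma fibmx_exp (R : comNzRingType) n :
  fibmx R ^+ n = (fib n)%:~R *: fibmx R + (fib n.+1 - fib n)%:~R%:A.
Proof.
elim: n => [|n IHn]; first by rewrite expr0 scale0r add0r subr0 scale1r.
rewrite exprS IHn mulrDr -!scalerAr -expr2 fibmx_sqr mulr1 wseqSS.
rewrite scalerDr addrAC -scalerDl -rmorphD; congr (_ *: _ + _%:~R *: _); ring.
Qed.

Lemma fibmx_exp00 n : (fibmx int ^+ n) 0 0 = fib n.+1 - fib n.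
Proof. by rewrite fibmx_exp !mxE /= mulr0 mulr1 add0r intz. Qed.

Lemma fibmx_exp01 n : (fibmx int ^+ n) 0 1 = fib n.
Proof. by rewrite fibmx_exp !mxE /= mulr0 mulr1 addr0 intz. Qed.

Lemma wseqD_fibmx (m : int) T (B : 'M[int]_2) a b n :
  fibmx int ^+ T = 1 + m *: B ->
  wseq a b (n + T) =
    wseq a b n + m * (B 0 0 * wseq a b n + B 0 1 * wseq a b n.+1).
Proof.
by move=> A_T; rewrite wseqD -fibmx_exp00 -fibmx_exp01 A_T !mxE /=; ring.
Qed.

(* 1 + m B has determinant 1, hence m divides the trace B_01 + 2 B_00 of B. *)
Lemma fibmx_trace (m : int) T (B : 'M[int]_2) :
  m != 0 -> ~~ odd T -> fibmx int ^+ T = 1 + m *: B ->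
  (m %| (B 0 1 + 2 * B 0 0)%R)%Z.
Proof.
move=> m_neq0 evenT A_T; have := fib_norm T.
have fT : fib T = m * B 0 1 by rewrite -fibmx_exp01 A_T !mxE /= add0r.
have -> : fib T.+1 = fib T + (1 + m * B 0 0).
  by apply/eqP; rewrite addrC -subr_eq -fibmx_exp00 A_T !mxE.
rewrite fT -signr_odd (negbTE evenT) expr0 => normE.
apply/dvdzP; exists (B 0 1 ^+ 2 - B 0 1 * B 0 0 - B 0 0 ^+ 2).
apply/(mulfI m_neq0)/(addIr 1); rewrite -[X in _ = _ + X]normE; ring.
Qed.

Lemma wseq_zeroD (a b d : int) n k :
  (d %| wseq a b n)%Z -> (d %| wseq a b (n + k) - wseq a b n.+1 * fib k)%Z.
Proof. by move=> dn; rewrite wseqD mulrC addrAC subrr add0r dvdz_mull. Qed.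

Lemma wseq_zeroM (a b d : int) n k i :
  (d %| wseq a b n)%Z -> (d %| fib k)%Z -> (d %| wseq a b (n + i * k))%Z.
Proof.
move=> dn dk; elim: i => [|i IHi]; first by rewrite addn0.
rewrite mulSn addnCA addnC wseqD.
by apply: rpredD; [exact: dvdz_mulr | exact: dvdz_mull].
Qed.

Lemma coprimez_wseq_zero (a b d : int) n :
  (d %| wseq a b n)%Z -> coprimez d (wseq a b n.+1) = coprimez d (wnorm a b).
Proof.
move=> /dvdzP [z wn]; rewrite -(coprimez_pexpr _ _ (isT : 0 < 2)%N).
rewrite (@coprimez_congr _ _ ((-1) ^+ n * wnorm a b)); last first.
  rewrite -wseq_norm wn; apply/dvdzP.
  by exists (z * (wseq a b n.+1 + z * d)); ring.
by rewrite -signr_odd; case: odd; rewrite ?mulN1r ?mul1r ?coprimezN.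
Qed.

Lemma wlucas_zeroD (a b d : int) n k :
  (d %| wseq a b n)%Z ->
  (d %| wlucas a b (n + k) - wseq a b n.+1 * wlucas 0 1 k)%Z.
Proof.
move=> dn; rewrite /wlucas -addnS.
have := rpredB (dvdz_mull 2 (wseq_zeroD k.+1 dn)) (wseq_zeroD k dn).
by congr (_ %| _)%Z; ring.
Qed.

(** * Lifting completeness *)

(* Only the terms w_n with wlucas a b n prime to q move through their lifts. *)
Definition regular_complete (q : nat) (a b : int) (m : nat) :=
  forall x, exists2 n, (m%:Z %| wseq a b n - x)%Z & coprimez q (wlucas a b n).

Lemma residue_completeP (a b : int) m :
  residue_complete a b m <-> regular_complete 1 a b m.
Proof.
split=> w_compl x; have [n] := w_compl x; last first.
  by move=> wn _; exists n; apply/eqP; rewrite eqz_mod_dvd.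
by move/eqP; rewrite eqz_mod_dvd; exists n; rewrite // coprimezE coprime1n.
Qed.

Lemma regular_complete_dvdl (a b : int) q r m :
  (q %| r)%N -> regular_complete r a b m -> regular_complete q a b m.
Proof.
move=> qr w_compl x; have [n wn cop_r] := w_compl x.
by exists n => //; apply: coprimez_dvdl qr cop_r.
Qed.

Lemma regular_complete_dvdr (a b : int) q d m :
  (d %| m)%N -> regular_complete q a b m -> regular_complete q a b d.
Proof.
move=> dm w_compl x; have [n wn cop_q] := w_compl x.
by exists n => //; apply: dvdz_trans wn.
Qed.

Lemma regular_complete_zero (a b : int) q m n :
  (q %| m)%N -> coprimez m (wnorm a b) -> (m%:Z %| wseq a b n)%Z ->
  regular_complete q 0 1 m -> regular_complete q a b m.
Proof.
move=> qm cop_m mn fib_compl x; rewrite -(coprimez_wseq_zero mn) in cop_m.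
have /coprimezP [[u v] /= uv] := cop_m.
have [k /dvdzP [z fk] cop_q] := fib_compl (v * x).
exists (n + k)%N.
  rewrite (dvdz_congr (y := wseq a b n.+1 * fib k - x)).
    apply/dvdzP; exists (wseq a b n.+1 * z - u * x).
    by rewrite -[fib k](subrK (v * x)) fk -[X in _ - X]mul1r -uv; ring.
  by rewrite opprD addrACA subrr addr0 (wseq_zeroD k mn).
have dvdz_qm : (q%:Z %| m%:Z)%Z := qm.
rewrite (coprimez_congr (dvdz_trans dvdz_qm (wlucas_zeroD k mn))) coprimezMr.
by rewrite cop_q (coprimez_dvdl qm cop_m).
Qed.

(* For the companion matrix A of the recurrence, B is the derivative of
   i |-> A ^ (i T) at the identity: modulo m ^ 2 the terms w_(n + i T) form an
   arithmetic progression of step m (B_00 w_n + B_01 w_(n+1)). *)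
Definition liftable (q m : nat) :=
  exists T (B : 'M[int]_2),
    [/\ ~~ odd T, fibmx int ^+ T = 1 + m%:Z *: B & coprimez q (B 0 0)].

Lemma liftableM (q r m : nat) :
  odd r -> (r %| m)%N -> (q %| m)%N -> liftable q m -> liftable q (r * m).
Proof.
move=> odd_r rm qm [T [B [evenT A_T cop_q]]].
have [|C A_rT] := @expr1D_scale _ m%:Z (r * m ^ 2)%N%:Z B r.
  move=> [|[|[|i]]] // _; rewrite -[_ *+ _]mulr_natr natz dvdzE abszM abszX /=.
    by rewrite bin2odd // mulnA (mulnC r) dvdn_mulr.
  by rewrite dvdn_mulr // (expnS _ i.+2) dvdn_mul // dvdn_exp2l.
exists (T * r)%N, (B + m%:Z *: C); split; first by rewrite oddM negb_and evenT.
  rewrite exprM A_T A_rT scalerDr addrA scalerA.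
  by congr (_ + _ *: _ + _ *: _); lia.
rewrite !mxE (coprimez_congr (y := B 0 0)) // addrAC subrr add0r.
by apply: dvdz_mulr.
Qed.

Lemma wseqD_fibmx_iter (m : int) T (B : 'M[int]_2) a b n i :
  fibmx int ^+ T = 1 + m *: B ->
  exists c, wseq a b (n + T * i) = wseq a b n +
    m * (i%:Z * (B 0 0 * wseq a b n + B 0 1 * wseq a b n.+1) + m * c).
Proof.
move=> A_T; have [|C A_iT] := @expr1D_scale _ m (m ^+ 2) B i.
  move=> j /andP [j_gt1 _]; rewrite -(subnKC j_gt1) exprD -mulrnAr.
  exact: dvdz_mulr (dvdzz _).
exists (C 0 0 * wseq a b n + C 0 1 * wseq a b n.+1).
rewrite (@wseqD_fibmx m (T * i) (i%:Z *: B + m *: C)); last first.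
  by rewrite exprM A_T A_iT scalerDr addrA !scalerA -[m *+ i]mulr_natr natz.
by rewrite !mxE; ring.
Qed.

Lemma regular_completeM (a b : int) q r m :
  (0 < m)%N -> (r %| q)%N -> (q %| m)%N -> liftable q m ->
  regular_complete q a b m -> regular_complete q a b (r * m).
Proof.
move=> m_gt0 rq qm [T [B [evenT A_T cop_q]]] w_compl x.
have m_neq0 : m%:Z != 0 by rewrite eqz_nat -lt0n.
have dvdz_qm : (q%:Z %| m%:Z)%Z := qm.
have [n /dvdzP [z wn] cop_n] := w_compl x.
pose u := B 0 0 * wseq a b n + B 0 1 * wseq a b n.+1.
have cop_u : coprimez r u.
  apply: coprimez_dvdl rq _.
  rewrite (@coprimez_congr _ _ (- (B 0 0 * wlucas a b n))).
    by rewrite coprimezN coprimezMr cop_q.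
  have := dvdz_mulr (wseq a b n.+1) (fibmx_trace m_neq0 evenT A_T).
  by move=> /(dvdz_trans dvdz_qm); congr (_ %| _)%Z; rewrite /u /wlucas; ring.
have r_gt0 := dvdn_gt0 (dvdn_gt0 m_gt0 qm) rq.
have [i /dvdzP [y zE]] := coprimez_linear_solvable z r_gt0 cop_u.
exists (n + T * i)%N.
  have [c ->] := wseqD_fibmx_iter a b n i A_T; rewrite -/u.
  have /dvdzP [s mE] : (r%:Z %| m%:Z)%Z := dvdn_trans rq qm.
  apply/dvdzP; exists (y + s * c); rewrite PoszM addrAC wn.
  have -> : z * m%:Z + m%:Z * (i%:Z * u + m%:Z * c) =
      m%:Z * (z + i%:Z * u) + m%:Z * (m%:Z * c) by ring.
  by rewrite zE [X in m%:Z * (X * c)]mE; ring.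
have period j : (q%:Z %| wseq a b (j + T * i) - wseq a b j)%Z.
  have [c ->] := wseqD_fibmx_iter a b j i A_T.
  by rewrite addrC addKr (dvdz_trans dvdz_qm) // dvdz_mulr.
rewrite (coprimez_congr (y := wlucas a b n)) // /wlucas -addSn.
have := rpredB (dvdz_mull 2 (period n.+1)) (period n).
by congr (_ %| _)%Z; ring.
Qed.

Lemma regular_complete_exp (a b : int) q r m k :
  odd r -> (0 < m)%N -> (r %| q)%N -> (q %| m)%N -> liftable q m ->
  regular_complete q a b m ->
  liftable q (r ^ k * m) /\ regular_complete q a b (r ^ k * m).
Proof.
move=> odd_r m_gt0 rq qm lift_m w_compl; elim: k => [|k [IHl IHc]].
  by rewrite mul1n.
have r_gt0 := dvdn_gt0 (dvdn_gt0 m_gt0 qm) rq.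
have qmk : (q %| r ^ k * m)%N by rewrite dvdn_mull.
rewrite expnS -mulnA; split.
  by apply: liftableM; rewrite // (dvdn_trans rq).
by apply: regular_completeM; rewrite // muln_gt0 expn_gt0 r_gt0.
Qed.

(** * Reduction to the Fibonacci sequence *)

Lemma wseq_periodic (a b : int) (m : nat) :
  (0 < m)%N ->
  exists2 T, (0 < T)%N & forall n, (m%:Z %| wseq a b (n + T) - wseq a b n)%Z.
Proof.
rewrite leq_eqVlt => /predU1P [<-|m_gt1].
  by exists 1%N => // n; apply: dvd1z.
pose step (z : 'Z_m * 'Z_m) := (z.2, z.1 + z.2).
have step_inj : injective step.
  by move=> [x y] [x' y'] /eqP /andP [/eqP /= -> /eqP /= /addIr ->].
pose z0 : 'Z_m * 'Z_m := (a%:~R, b%:~R).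
have iter_step n : iter n step z0 = ((wseq a b n)%:~R, (wseq a b n.+1)%:~R).
  by elim: n => [//|n IHn]; rewrite iterS IHn wseqSS addrC rmorphD.
exists (order step z0) => [|n]; first exact: order_gt0.
have := iter_step (n + order step z0)%N; rewrite iterD iter_order // iter_step.
by move/(congr1 fst) => /= wn; rewrite dvdz_Zp // rmorphB /= wn subrr.
Qed.

Lemma residue_complete_shift (a b : int) (m N : nat) :
  (0 < m)%N -> residue_complete a b m ->
  residue_complete (wseq a b N) (wseq a b N.+1) m.
Proof.
move=> m_gt0 w_compl x; have [n wn] := w_compl x.
have [T T_gt0 period] := wseq_periodic a b m_gt0.
have le_N : (N <= n + N * T)%N.
  by rewrite (leq_trans _ (leq_addl _ _)) // leq_pmulr.
exists (n + N * T - N)%N; rewrite wseq_shift subnKC // -wn.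
elim: (N) => [|i IHi]; first by rewrite addn0.
by rewrite -IHi mulSn addnCA addnC; apply/eqP; rewrite eqz_mod_dvd.
Qed.

Lemma residue_complete_fib (a b : int) (m : nat) :
  (0 < m)%N -> residue_complete a b m ->
  coprimez m (wnorm a b) /\ residue_complete 0 1 m.
Proof.
move=> m_gt0 w_compl.
have [n /eqP] := w_compl 0; rewrite eqz_mod_dvd subr0 => mn.
have fib_mul x : exists k, (m%:Z %| wseq a b n.+1 * fib k - x)%Z.
  have [k /eqP] := residue_complete_shift n m_gt0 w_compl x.
  rewrite wseq_shift eqz_mod_dvd => wk; exists k.
  have := rpredB wk (wseq_zeroD k mn).
  by congr (_ %| _)%Z; rewrite opprB addrC addrA subrK.
have cop_w : coprimez m (wseq a b n.+1).
  have [k /dvdzP [z w_fk]] := fib_mul 1.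
  apply/coprimezP; exists (- z, fib k) => /=.
  by rewrite mulrC mulrN mulrC -w_fk; ring.
split; first by rewrite -(coprimez_wseq_zero mn).
move=> x; have [k mk] := fib_mul (wseq a b n.+1 * x); exists k; apply/eqP.
by rewrite eqz_mod_dvd -(Gauss_dvdzr _ cop_w) mulrBr.
Qed.

(** * Verifications modulo small integers *)

Definition residue (m : nat) (x : int) : nat := `|(x %% m%:Z)%Z|%N.

Lemma residueE m x : (0 < m)%N -> (residue m x)%:Z = (x %% m%:Z)%Z.
Proof. by move=> m_gt0; rewrite gez0_abs // modz_ge0 // eqz_nat -lt0n. Qed.

Lemma residue_nat m n : residue m n%:Z = (n %% m)%N.
Proof. by rewrite /residue modz_nat. Qed.

Lemma mem_residue m x : (0 < m)%N -> residue m x \in iota 0 m.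
Proof.
by move=> m_gt0; rewrite mem_iota /= -ltz_nat residueE // ltz_pmod.
Qed.

Lemma dvdz_sub_residue m x : (0 < m)%N -> (m%:Z %| x - (residue m x)%:Z)%Z.
Proof. by move=> m_gt0; rewrite residueE // -eqz_mod_dvd modz_mod. Qed.

Lemma eq_residue m x y :
  (0 < m)%N -> (residue m x == residue m y) = (m%:Z %| x - y)%Z.
Proof. by move=> m_gt0; rewrite -eqz_nat !residueE // eqz_mod_dvd. Qed.

Lemma residueD m x y :
  (0 < m)%N -> residue m (x + y) = ((residue m x + residue m y) %% m)%N.
Proof.
move=> m_gt0; rewrite -residue_nat; apply/eqP; rewrite eq_residue // PoszD.
by rewrite opprD addrACA rpredD ?dvdz_sub_residue.
Qed.

Lemma wnorm_residue (a b : int) m :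
  (0 < m)%N ->
  (m%:Z %| wnorm (residue m a)%:Z (residue m b)%:Z - wnorm a b)%Z.
Proof.
move=> m_gt0.
have /dvdzP [u aE] := dvdz_sub_residue a m_gt0.
have /dvdzP [v bE] := dvdz_sub_residue b m_gt0.
rewrite (_ : (residue m a)%:Z = a - u * m%:Z); last by rewrite -aE; ring.
rewrite (_ : (residue m b)%:Z = b - v * m%:Z); last by rewrite -bE; ring.
apply/dvdzP; exists (u * b + v * a - u * v * m%:Z + u * (2 * a - u * m%:Z)
  - v * (2 * b - v * m%:Z)).
by ring.
Qed.

Definition fib_step (m : nat) (z : nat * nat) : nat * nat :=
  (z.2, (z.1 + z.2) %% m)%N.

Lemma iter_fib_step (a b : int) m n :
  (0 < m)%N ->
  iter n (fib_step m) (residue m a, residue m b) =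
    (residue m (wseq a b n), residue m (wseq a b n.+1)).
Proof.
by move=> m_gt0; elim: n => [//|n IHn]; rewrite iterS IHn wseqSS addrC residueD.
Qed.

Definition fib_start (m : nat) : nat * nat := (0, 1 %% m)%N.

Lemma iter_fib_start m n :
  (0 < m)%N ->
  iter n (fib_step m) (fib_start m) = (residue m (fib n), residue m (fib n.+1)).
Proof. by move=> m_gt0; rewrite -iter_fib_step // !residue_nat mod0n. Qed.

Definition zero_period (m T : nat) : Prop :=
  (m%:Z %| fib T)%Z /\
  forall a b, coprimez m (wnorm a b) -> exists n, (m%:Z %| wseq a b n)%Z.

Lemma zero_periodM (m1 m2 T1 T2 : nat) :
  coprime m1 m2 -> coprime T1 T2 -> (0 < T1 * T2)%N ->
  zero_period m1 T1 -> zero_period m2 T2 -> zero_period (m1 * m2) (T1 * T2).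
Proof.
move=> cop_m cop_T T_gt0 [fib1 zero1] [fib2 zero2].
have dvd_mul x : ((m1 * m2)%N%:Z %| x)%Z = (m1%:Z %| x)%Z && (m2%:Z %| x)%Z.
  by rewrite PoszM Gauss_dvdz ?coprimezE.
split=> [|a b].
  rewrite dvd_mul; apply/andP; split.
    by rewrite mulnC; apply: @wseq_zeroM 0 1 _ 0 _ _ (dvdz0 _) fib1.
  exact: @wseq_zeroM 0 1 _ 0 _ _ (dvdz0 _) fib2.
rewrite PoszM coprimezMl => /andP [/zero1 [n1 w1] /zero2 [n2 w2]].
pose n := (chinese T1 T2 n1 n2 + (n1 + n2) * (T1 * T2))%N; exists n.
have le_n : (n1 + n2 <= n)%N.
  by rewrite (leq_trans _ (leq_addl _ _)) // leq_pmulr.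
have zero m T i : (m%:Z %| wseq a b i)%Z -> (m%:Z %| fib T)%Z ->
    (i <= n)%N -> n = i %[mod T] -> (m%:Z %| wseq a b n)%Z.
  move=> wi fT le_in /eqP; rewrite eqn_mod_dvd // => /dvdnP [j nE].
  by rewrite -(subnKC le_in) nE wseq_zeroM.
rewrite dvd_mul; apply/andP; split.
  apply: zero w1 fib1 (leq_trans (leq_addr _ _) le_n) _.
  by rewrite /n mulnCA -modnDmr modnMr addn0 chinese_modl.
apply: zero w2 fib2 (leq_trans (leq_addl _ _) le_n) _.
by rewrite /n mulnA -modnDmr modnMl addn0 chinese_modr.
Qed.

Definition zero_period_table (m T : nat) : bool :=
  ((iter T (fib_step m) (fib_start m)).1 == 0)%N &&
  all (fun x => all (fun y => coprimez m (wnorm x%:Z y%:Z) ==>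
      has (fun z => z.1 == 0)%N (traject (fib_step m) (x, y) T))
    (iota 0 m)) (iota 0 m).

Lemma zero_period_tableP m T :
  zero_period_table m T -> (0 < m)%N -> zero_period m T.
Proof.
move=> /andP [fib_T /allP zeros] m_gt0.
have residue0 x : (residue m x == 0)%N = (m%:Z %| x)%Z.
  by rewrite -(mod0n m) -residue_nat eq_residue // subr0.
rewrite iter_fib_start // residue0 in fib_T.
split=> // a b cop_m.
have /allP /(_ _ (mem_residue b m_gt0)) := zeros _ (mem_residue a m_gt0).
rewrite (coprimez_congr (y := wnorm a b)); last exact: wnorm_residue.
rewrite cop_m => /hasP [_ /trajectP [n _ ->]].
by rewrite iter_fib_step //= residue0; exists n.
Qed.

Definition regular_table (q m T : nat) : bool :=
  all (fun x => has (fun z => (z.1 == x) && coprimez q (2 * z.2%:Z - z.1%:Z))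
      (traject (fib_step m) (fib_start m) T))
    (iota 0 m).

Lemma regular_tableP q m T :
  regular_table q m T -> (0 < m)%N -> (q %| m)%N -> regular_complete q 0 1 m.
Proof.
move=> /allP table m_gt0 qm x; have dvdz_qm : (q%:Z %| m%:Z)%Z := qm.
have /hasP [_ /trajectP [n _ ->]] := table _ (mem_residue x m_gt0).
rewrite iter_fib_start //= eq_residue // => /andP [fn cop_q]; exists n => //.
rewrite -(coprimez_congr
  (x := 2 * (residue m (fib n.+1))%:Z - (residue m (fib n))%:Z)) //.
apply: (dvdz_trans dvdz_qm).
have := rpredB (dvdz_sub_residue (fib n) m_gt0)
  (dvdz_mull 2 (dvdz_sub_residue (fib n.+1) m_gt0)).
by congr (_ %| _)%Z; rewrite /wlucas; ring.
Qed.

Definition lift_table (q m T : nat) : bool :=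
  let z := iter T (fib_step (q * m)) (fib_start (q * m)) in
  (m %| z.1)%N && (gcdz (q * m)%N (z.2%:Z - z.1%:Z - 1) == m).

Lemma lift_tableP q m T :
  lift_table q m T -> ~~ odd T -> (0 < m)%N -> (0 < q)%N -> liftable q m.
Proof.
move=> + evenT m_gt0 q_gt0.
have qm_gt0 : (0 < q * m)%N by rewrite muln_gt0 q_gt0.
have m_qm : (m%:Z %| (q * m)%N%:Z)%Z by rewrite dvdzE /= dvdn_mull.
have m_neq0 : m%:Z != 0 by rewrite eqz_nat -lt0n.
rewrite /lift_table iter_fib_start //= => /andP [].
rewrite -[(m %| _)%N]/(m%:Z %| (residue (q * m) (fib T))%:Z)%Z.
rewrite -(dvdz_congr (dvdz_trans m_qm (dvdz_sub_residue (fib T) qm_gt0))).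
case/dvdzP=> s fT.
rewrite -(@gcdz_congr _ (fib T.+1 - fib T - 1)); last first.
  have := rpredB (dvdz_sub_residue (fib T.+1) qm_gt0)
    (dvdz_sub_residue (fib T) qm_gt0).
  by congr (_ %| _)%Z; ring.
move=> /eqP gcd_m.
have /dvdzP [t tE] : (m%:Z %| fib T.+1 - fib T - 1)%Z.
  by rewrite -gcd_m dvdz_gcdr.
exists T, (s *: fibmx int + t%:A); split=> //.
  have fibB : fib T.+1 - fib T = 1 + t * m%:Z by rewrite -tE; ring.
  rewrite fibmx_exp !intz fibB fT.
  by rewrite scalerDr !scalerA scalerDl scale1r addrCA (mulrC s) (mulrC t).
rewrite !mxE /= mulr0 add0r mulr1 /coprimez.
by apply/eqP/(mulIf m_neq0); rewrite mul1r -[RHS]gcd_m tE PoszM -mulz_gcdl.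
Qed.

Lemma fib_not_complete_avoid (m T x : nat) :
  (0 < m)%N -> looping (fib_step m) (fib_start m) T ->
  all (fun z => z.1 != x %% m)%N (traject (fib_step m) (fib_start m) T) ->
  ~ residue_complete 0 1 m.
Proof.
move=> m_gt0 /loopingP loop /allP avoid /(_ x%:Z) [n /eqP].
rewrite eqz_mod_dvd -eq_residue // residue_nat => fn.
by have := avoid _ (loop n); rewrite iter_fib_start //= fn.
Qed.

(** * Primes above 7 *)

Lemma fib_docagne j n :
  (-1) ^+ n * fib j = fib (j + n) * fib n.+1 - fib (j + n).+1 * fib n.
Proof. by rewrite -fib_norm -addSn !wseqD wseqSS; ring. Qed.

(* Frobenius applied to 2 A - 1, whose square is 5. *)
Lemma fib_pchar (F : fieldType) (p : nat) :
  p \in [pchar F] -> odd p ->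
  (fib p)%:~R = 5 ^+ p./2 :> F /\ 2 * (fib p.+1)%:~R = 1 + 5 ^+ p./2 :> F.
Proof.
move=> p_char p_odd; have two_neq0 : 2 != 0 :> F.
  rewrite -(dvdn_pcharf p_char) dvdn_prime2 ?(pcharf_prime p_char) //.
  by apply: contraTneq p_odd => ->.
have pM : p \in [pchar 'M[F]_2] by rewrite pchar_lalg.
pose B : 'M[F]_2 := 2 *: fibmx F - 1.
have B_sqr : B ^+ 2 = 5%:A.
  apply/matrixP=> i j; rewrite expr2 -mulmxE !mxE !big_ord_recl big_ord0 !mxE.
  by case: i j => [[|[|//]] ?] [[|[|//]] ?] /=; ring.
have B_p : B ^+ p = 5 ^+ p./2 *: B.
  rewrite -[in LHS](odd_double_half p) p_odd exprS -muln2 mulnC exprM B_sqr.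
  by rewrite exprZn expr1n -scalerAr mulr1.
have : B ^+ p = 2 *: fibmx F ^+ p - 1.
  rewrite -!(pFrobenius_autE pM) pFrobenius_autB_comm; last exact: commr1.
  by rewrite pFrobenius_aut1 !scaler_nat pFrobenius_autMn.
rewrite B_p fibmx_exp => /matrixP eqB; have := eqB 0 1; have := eqB 0 0.
rewrite !mxE /= !(mulr0, mulr1, add0r, addr0, subr0) intrB => eqB00 eqB01.
have fp : (fib p)%:~R = 5 ^+ p./2 :> F.
  by apply: (mulfI two_neq0); rewrite -eqB01; ring.
split=> //; rewrite -[LHS](subrK (2 * (fib p)%:~R)) -mulrBr.
by rewrite -[2 * (_ - _)](subrK 1) -eqB00 fp; ring.
Qed.

Lemma intr_fibD (R : pzRingType) n k :
  (fib (n + k))%:~R =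
    (fib k)%:~R * (fib n.+1)%:~R + ((fib k.+1)%:~R - (fib k)%:~R) * (fib n)%:~R
    :> R.
Proof. by rewrite wseqD intrD !intrM intrB. Qed.

Lemma intr_fib_lucas_sqr (R : comNzRingType) n :
  (2 * (fib n.+1)%:~R - (fib n)%:~R) ^+ 2 =
    5 * (fib n)%:~R ^+ 2 + 4 * (-1) ^+ n :> R.
Proof.
have /(congr1 (fun z : int => z%:~R : R)) := wlucas_sqr 0 1 n.
rewrite /wlucas expr1n mul0r expr0n !subr0 mulr1.
by rewrite !(rmorphXn, rmorphD, rmorphM, rmorphB, rmorphN, rmorph1).
Qed.

Definition fib_surjective (R : pzRingType) :=
  forall x : R, exists n, (fib n)%:~R = x.

(* fib 1 = fib 2 saves one value. *)
Lemma card_fib_surjective (F : finFieldType) d N :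
  fib_surjective F -> (0 < d)%N -> (1 < N)%N ->
  (forall n, exists2 r, (r <= N)%N &
    (fib n)%:~R ^+ d = (fib r)%:~R ^+ d :> F) ->
  (#|F| <= d * N)%N.
Proof.
move=> F_surj d_gt0 N_gt1 reduce.
pose s : seq F := [seq (fib r)%:~R ^+ d | r <- 0%N :: iota 2 N.-1].
have -> : N = size s by rewrite size_map /= size_iota prednK // ltnW.
apply: card_leq_exp_image d_gt0 _ => x; have [n <-] := F_surj x.
have [[|[|r]] r_le ->] := reduce n; first exact: mem_head.
  by apply: (map_f _ (_ : 2 \in _)); rewrite inE mem_iota; lia.
by apply: (map_f (fun i => (fib i)%:~R ^+ d)); rewrite inE mem_iota; lia.
Qed.

Lemma not_fib_surjective_3mod4 (F : finFieldType) :
  odd #|F| -> odd #|F|./2 -> 2 != 0 :> F -> 3 != 0 :> F -> 7 != 0 :> F ->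
  quad_char (5 : F) = -1 -> ~ fib_surjective F.
Proof.
move=> odd_F odd_k two_neq0 three_neq0 seven_neq0 chi5 F_surj.
have [v [chiB chi_v chiD]] :=
  consecutive_quad_char_eqN1 odd_F two_neq0 three_neq0 seven_neq0 odd_k.
have chi4 := quad_char4 odd_F two_neq0.
have five_neq0 := quad_char_eqN1_neq0 odd_F chi5.
have /(sqr_quad_char1 odd_F odd_k) sqr_v : quad_char (4 * v / 5) = 1.
  by rewrite !quad_charM quad_charV chi4 chi_v chi5 invrN1; ring.
have [n fn] := F_surj ((4 * v / 5) ^+ uphalf #|F|./2).
have := intr_fib_lucas_sqr F n.
rewrite fn sqr_v -fn mulrCA divff // mulr1 -mulrDr.
set L := _ - _ => L_sqr.
have chiL : quad_char (L ^+ 2) = -1.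
  by rewrite L_sqr quad_charM chi4 mul1r -signr_odd; case: odd.
have L_neq0 : L != 0.
  by have := quad_char_eqN1_neq0 odd_F chiL; rewrite expf_eq0.
have := chiL; rewrite quad_char_sqr // => /eqP.
by rewrite -subr_eq0 opprK (negbTE two_neq0).
Qed.

Section FibModPrime.
Variable p : nat.
Hypotheses (p_prime : prime p) (p_gt7 : (7 < p)%N).

Local Notation f n := ((fib n)%:~R : 'F_p).
Local Notation chi := (@quad_char 'F_p).

Let p_odd : odd p.
Proof. by case: (even_prime p_prime) => // p2; move: p_gt7; rewrite p2. Qed.

Let pE : p = p./2.*2.+1.
Proof. by rewrite -{1}(odd_double_half p) p_odd. Qed.

Let two_neq0 : 2 != 0 :> 'F_p. Proof. by apply: natr_Fp_neq0 => //; lia. Qed.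

Lemma not_fib_surjective_split : chi 5 = 1 -> ~ fib_surjective 'F_p.
Proof.
rewrite /quad_char card_Fp // => chi5 F_surj.
have [] := fib_pchar (pchar_Fp p_prime) p_odd; rewrite chi5 => fp fp1.
have p_gt0 := prime_gt0 p_prime.
have {}fp1 : f p.+1 = 1 by apply: (mulfI two_neq0); rewrite fp1 mulr1.
have fpB1 : f p.-1 = 0.
  have -> : fib p.-1 = fib p.+1 - fib p.
    by rewrite -{2 3}(prednK p_gt0) wseqSS addrC addKr.
  by rewrite intrB fp fp1 subrr.
have period n : f (n + p.-1) = f n.
  by rewrite intr_fibD fpB1 prednK // fp mul0r subr0 mul1r add0r.
have := @card_fib_surjective 'F_p 1 (p - 2) F_surj isT.
rewrite card_Fp // mul1n => le_p.
suff : (p <= p - 2)%N by lia.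
apply: le_p => [|n]; first by lia.
exists (n %% p.-1)%N; last by rewrite -(periodic_modn period n).
by rewrite -ltnS (leq_trans (ltn_pmod _ _)) //; lia.
Qed.

Lemma fib_half_eq0 : ~~ odd p./2 -> chi 5 = -1 -> f p./2.+1 = 0.
Proof.
move=> even_k chi5; have odd_F : odd #|'F_p| by rewrite card_Fp.
have [_] := fib_pchar (pchar_Fp p_prime) p_odd.
rewrite (_ : 5 ^+ p./2 = -1 :> 'F_p) ?subrr; last first.
  by rewrite -chi5 /quad_char card_Fp.
set h := p./2.+1; have -> : p.+1 = (h + h)%N by rewrite /h {1}pE; lia.
rewrite intr_fibD => /eqP; rewrite mulf_eq0 (negbTE two_neq0) /= => /eqP f2h.
apply/eqP; apply: contraT => fh_neq0.
have L_eq0 : 2 * f h.+1 - f h = 0.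
  by apply: (mulfI fh_neq0); rewrite mulr0 -f2h; ring.
have := intr_fib_lucas_sqr 'F_p h.
rewrite L_eq0 expr0n -signr_odd /= even_k mulrN1 => /esym/eqP.
rewrite subr_eq0 => /eqP five_sqr.
have : chi 5 = 1.
  have -> : 5 = (2 / f h) ^+ 2.
    by rewrite expr_div_n -[2 ^+ 2]natrX -five_sqr mulfK // expf_neq0.
  by rewrite quad_char_sqr // mulf_neq0 ?invr_eq0.
by rewrite chi5 => /esym/eqP; rewrite -subr_eq0 opprK (negbTE two_neq0).
Qed.

Lemma not_fib_surjective_1mod4 :
  ~~ odd p./2 -> chi 5 = -1 -> ~ fib_surjective 'F_p.
Proof.
move=> even_k chi5 F_surj; have fh := fib_half_eq0 even_k chi5.
set h := p./2.+1 in fh; set g := f h.+1.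
have N1_exp4 : (-1) ^+ 4 = 1 :> 'F_p by rewrite -signr_odd.
have g_sqr : g ^+ 2 = -1.
  have /(congr1 (fun z : int => z%:~R : 'F_p)) := fib_norm h.
  rewrite !intrB intrM !rmorphXn /= fh mul0r expr0n !subr0 => ->.
  by rewrite intrN -signr_odd /= even_k.
have g4 : g ^+ 4 = 1 by rewrite (exprM g 2 2) g_sqr sqrrN expr1n.
have period n : f (n + h) ^+ 4 = f n ^+ 4.
  by rewrite intr_fibD fh mul0r subr0 add0r exprMn g4 mul1r.
have reflection n : (n <= h)%N -> f (h - n) ^+ 4 = f n ^+ 4.
  move=> le_n; have := fib_docagne (h - n) n.
  move/(congr1 (fun z : int => z%:~R ^+ 4 : 'F_p)).
  rewrite subnK // intrM intrB !intrM fh mul0r sub0r /=.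
  rewrite rmorph_sign exprMn -exprM mulnC exprM N1_exp4 expr1n mul1r => ->.
  by rewrite exprNn N1_exp4 mul1r exprMn g4 mul1r.
have := @card_fib_surjective 'F_p 4 p./2./2 F_surj isT.
rewrite card_Fp // => le_p.
suff : (p <= 4 * p./2./2)%N by lia.
apply: le_p => [|n]; first by lia.
have [small|large] := leqP (n %% h)%N p./2./2.
  by exists (n %% h)%N; rewrite // (periodic_modn period).
have := ltn_pmod n (ltn0Sn p./2); rewrite -/h => lt_h.
exists (h - n %% h)%N; first by lia.
by rewrite reflection ?(periodic_modn period) // ltnW.
Qed.

Lemma not_fib_surjective : ~ fib_surjective 'F_p.
Proof.
have card_k : #|'F_p|./2 = p./2 by rewrite card_Fp.
have odd_F : odd #|'F_p| by rewrite card_Fp.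
have five_neq0 : 5 != 0 :> 'F_p by apply: natr_Fp_neq0 => //; lia.
have [chi5|chi5] := quad_char_sign odd_F five_neq0.
  exact: not_fib_surjective_split.
have [odd_k|even_k] := boolP (odd p./2).
  by apply: not_fib_surjective_3mod4; rewrite ?card_k //;
    apply: natr_Fp_neq0 => //; lia.
exact: not_fib_surjective_1mod4.
Qed.
End FibModPrime.

Lemma fib_not_complete_prime (p : nat) :
  prime p -> (7 < p)%N -> ~ residue_complete 0 1 p.
Proof.
move=> p_prime p_gt7 fib_compl; apply: (not_fib_surjective p_prime p_gt7) => x.
have [n /eqP] := fib_compl (nat_of_ord x)%:Z.
rewrite eqz_mod_dvd (dvdz_pcharf (pchar_Fp p_prime)) rmorphB subr_eq0.
by move/eqP=> fn; exists n; apply: etrans fn _; apply: natr_Zp.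
Qed.

(** * The family of moduli *)

Lemma residue_complete_pow5 (a b : int) (m T k : nat) :
  (0 < m)%N -> (0 < T)%N -> coprime m 5 -> coprime T 5 -> zero_period m T ->
  regular_complete 5 0 1 (m * 5) -> liftable 5 (m * 5) ->
  coprimez (m * 5 ^ k)%N (wnorm a b) -> residue_complete a b (m * 5 ^ k).
Proof.
move=> m_gt0 T_gt0 cop_m cop_T zero_m fib_compl lift_m cop_N.
apply/residue_completeP; case: k cop_N => [|k] cop_N.
  rewrite muln1 in cop_N *; have [n wn] := zero_m.2 a b cop_N.
  apply: regular_complete_zero (dvd1n _) cop_N wn _.
  apply: regular_complete_dvdl (dvd1n 5) (regular_complete_dvdr _ fib_compl).
  exact: dvdn_mulr.
have zero_5 : zero_period 5 5 by apply: zero_period_tableP; vm_compute.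
have T5_gt0 : (0 < T * 5)%N by rewrite muln_gt0 T_gt0.
have [_ zero_5m] := zero_periodM cop_m cop_T T5_gt0 zero_m zero_5.
have cop_5m : coprimez (m * 5)%N (wnorm a b).
  by apply: coprimez_dvdl cop_N; rewrite expnS mulnA dvdn_mulr.
have [n wn] := zero_5m a b cop_5m.
have w_compl :=
  regular_complete_zero (dvdn_mull m (dvdnn 5)) cop_5m wn fib_compl.
rewrite expnSr mulnCA; apply: regular_complete_dvdl (dvd1n 5) _.
by apply: (regular_complete_exp k _ _ _ _ lift_m w_compl).2;
  rewrite ?muln_gt0 ?m_gt0 ?dvdn_mull.
Qed.

Lemma residue_complete_pow3_pow5 (a b : int) (j k : nat) :
  coprimez (3 ^ j.+1 * 5 ^ k)%N (wnorm a b) ->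
  residue_complete a b (3 ^ j.+1 * 5 ^ k).
Proof.
have zero_3 : zero_period 3 4 by apply: zero_period_tableP; vm_compute.
move=> cop_N; apply/residue_completeP; case: k cop_N => [|k] cop_N.
  rewrite muln1 in cop_N *.
  have cop_3 : coprimez 3 (wnorm a b).
    by apply: coprimez_dvdl cop_N; rewrite dvdn_exp.
  have [n wn] := zero_3.2 a b cop_3.
  have fib_compl : regular_complete 3 0 1 3.
    by apply: (@regular_tableP _ _ 8); vm_compute.
  have lift_3 : liftable 3 3 by apply: (@lift_tableP _ _ 8); vm_compute.
  rewrite expnSr; apply: regular_complete_dvdl (dvd1n 3) _.
  apply: (regular_complete_exp j _ _ _ _ lift_3 _).2 => //.
  exact: regular_complete_zero cop_3 wn fib_compl.
have zero_5 : zero_period 5 5 by apply: zero_period_tableP; vm_compute.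
have [_ zero_15] : zero_period (3 * 5) (4 * 5) by exact: zero_periodM.
have cop_15 : coprimez 15 (wnorm a b).
  by apply: coprimez_dvdl cop_N; rewrite !expnS mulnACA dvdn_mulr.
have [n wn] := zero_15 a b cop_15.
have fib_compl : regular_complete 15 0 1 15.
  by apply: (@regular_tableP _ _ 40); vm_compute.
have lift_15 : liftable 15 15 by apply: (@lift_tableP _ _ 40); vm_compute.
have w_compl := regular_complete_zero (dvdnn 15) cop_15 wn fib_compl.
have [lift_3j compl_3j] :
    liftable 15 (3 ^ j * 15) /\ regular_complete 15 a b (3 ^ j * 15).
  exact: regular_complete_exp.
have -> : (3 ^ j.+1 * 5 ^ k.+1 = 5 ^ k * (3 ^ j * 15))%N by rewrite !expnS; lia.
apply: regular_complete_dvdl (dvd1n 15) _.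
apply: (regular_complete_exp k _ _ _ _ lift_3j compl_3j).2 => //.
  by rewrite muln_gt0 expn_gt0.
by rewrite dvdn_mull.
Qed.

Lemma residue_complete_pow5_table (a b : int) (m T N k : nat) :
  (0 < m)%N -> (0 < T)%N -> coprime m 5 -> coprime T 5 -> ~~ odd N ->
  zero_period_table m T -> regular_table 5 (m * 5) N ->
  lift_table 5 (m * 5) N ->
  coprimez (m * 5 ^ k)%N (wnorm a b) -> residue_complete a b (m * 5 ^ k).
Proof.
move=> m_gt0 T_gt0 cop_m cop_T evenN zeros regular lift.
have m5_gt0 : (0 < m * 5)%N by rewrite muln_gt0 m_gt0.
apply: (residue_complete_pow5 m_gt0 T_gt0 cop_m cop_T).
- exact: zero_period_tableP.
- by apply: regular_tableP regular _ _; rewrite // dvdn_mull.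
exact: lift_tableP lift _ _ _.
Qed.

Lemma famF_residue_complete (a b : int) (m : nat) :
  famF m -> coprimez m (wnorm a b) -> residue_complete a b m.
Proof.
case=> k [->|[->|[->|[[[|j] [//= _ ->]]|[->|[->|->]]]]]].
- rewrite -[(5 ^ k)%N]mul1n.
  by apply: (@residue_complete_pow5_table _ _ 1 1 20); vm_compute.
- by apply: (@residue_complete_pow5_table _ _ 2 3 60); vm_compute.
- by apply: (@residue_complete_pow5_table _ _ 4 6 60); vm_compute.
- exact: residue_complete_pow3_pow5.
- by apply: (@residue_complete_pow5_table _ _ 6 12 120); vm_compute.
- by apply: (@residue_complete_pow5_table _ _ 7 8 80); vm_compute.
by apply: (@residue_complete_pow5_table _ _ 14 24 240); vm_compute.
Qed.

Lemma fib_not_complete_small (d : nat) :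
  d \in [:: 8; 12; 18; 21; 28; 49]%N -> ~ residue_complete 0 1 d.
Proof.
rewrite !inE => /or4P [|||/or3P []] /eqP ->.
- by apply: (@fib_not_complete_avoid _ 12 4); vm_compute.
- by apply: (@fib_not_complete_avoid _ 24 6); vm_compute.
- by apply: (@fib_not_complete_avoid _ 24 4); vm_compute.
- by apply: (@fib_not_complete_avoid _ 16 4); vm_compute.
- by apply: (@fib_not_complete_avoid _ 48 10); vm_compute.
- by apply: (@fib_not_complete_avoid _ 112 4); vm_compute.
Qed.

Lemma famF_of_fib_complete (m : nat) :
  (0 < m)%N -> (forall d, (d %| m)%N -> residue_complete 0 1 d) -> famF m.
Proof.
move=> m_gt0 fib_compl.
have mE := prod_pfactor (s := [:: 2; 3; 5; 7]%N) m_gt0 isT.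
rewrite !big_cons big_nil muln1 in mE.
move: (logn 2 m) (logn 3 m) (logn 5 m) (logn 7 m) mE => i j k l mE.
have {}mE : (m = 2 ^ i * 3 ^ j * 5 ^ k * 7 ^ l)%N.
  rewrite -!mulnA; apply: mE => p.
  rewrite mem_primes m_gt0 => /and3P [p_prime _ pm].
  have : (p <= 7)%N.
    rewrite leqNgt; apply/negP => /(fib_not_complete_prime p_prime).
    by apply; apply: fib_compl.
  by case: p p_prime pm => [|[|[|[|[|[|[|[|]]]]]]]].
have excluded i' j' l' :
    (2 ^ i' * 3 ^ j' * 7 ^ l' \in [:: 8; 12; 18; 21; 28; 49])%N ->
    ~~ [&& i' <= i, j' <= j & l' <= l]%N.
  move=> /fib_not_complete_small not_compl.
  apply/negP => /and3P [le_i le_j le_l].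
  apply/not_compl/fib_compl; rewrite mE dvdn_mul ?dvdn_exp2l // dvdn_mulr //.
  by rewrite dvdn_mul ?dvdn_exp2l.
exists k; move: (excluded 3 0 0 isT)%N (excluded 2 1 0 isT)%N.
move: (excluded 1 2 0 isT)%N (excluded 0 1 1 isT)%N.
move: (excluded 2 0 1 isT)%N (excluded 0 0 2 isT)%N.
rewrite mE; clear; case: j => [|j]; first case: l => [|[|l]] //;
  last case: l => [|l] //.
- by case: i => [|[|[|i]]] //= _ _ _ _ _ _; rewrite !muln1 ?mul1n; tauto.
- by case: i => [|[|i]] //= _ _ _ _ _ _;
    rewrite muln1 ?mul1n mulnC ?mulnA; tauto.
rewrite muln1; case: i => [|[|i]] //.
  by move=> *; rewrite mul1n; do 3 right; left; exists j.+1.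
by case: j => [|j] // *; do 4 right; left.
Qed.

Unset Implicit Arguments.

Theorem theorem2p5 (a b : int) (m : nat) (m_gt0 : (0 < m)%N) :
  residue_complete a b m <->
  famF m /\ gcdz m%:Z (b ^+ 2 - a * b - a ^+ 2) = 1.
Proof.
split=> [w_compl | [Fm /eqP cop_m]]; last exact: famF_residue_complete.
have [cop_m fib_compl] := residue_complete_fib m_gt0 w_compl.
split; last exact/eqP.
apply: famF_of_fib_complete => // d dm.
have /residue_completeP fib_regular := fib_compl.
exact/residue_completeP/(regular_complete_dvdr dm).
Qed.
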